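(* Let $a, b, c$ be three integers whose sum $a+b+c$, product $abc$, and sum of products taken two at a time $ab+bc+ca$ are all perfect squares. Then each of the three integers $a, b, c$ must be a sum of two squares of rational numbers, of which one may possibly be zero. Thus, in any solution, either exactly one of the integers $a, b, c$ is a square, or all three of them are squares, or none of them is a square.
   Context: A perfect square (or square) is the square of an integer. A ''solution'' means a triple of integers $a,b,c$ such that $a+b+c$, $ab+bc+ca$ and $abc$ are all perfect squares. *)

(* Defs.v *)
From mathcomp Require Import all_boot all_order all_algebra.

Set Implicit Arguments.
Unset Strict Implicit.
Unset Printing Implicit Defensive.

Import GRing.Theory.
Local Open Scope ring_scope.

Definition perfect_square (n : int) : Prop := exists k : int, n = k ^+ 2.

Definition sum_of_two_rational_squares (n : int) : Prop :=
  exists x y : rat, n%:~R = x ^+ 2 + y ^+ 2.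

Definition exactly_one (P Q R : Prop) : Prop :=
  [\/ [/\ P, ~ Q & ~ R], [/\ ~ P, Q & ~ R] | [/\ ~ P, ~ Q & R]].

(* Main.v *)
Require Import Defs.
From mathcomp Require Import all_boot all_order all_algebra.
From mathcomp Require Import ring.

Import GRing.Theory.
Local Open Scope ring_scope.

(** Each of [a], [b], [c] is a root of [x^3 - r^2 x^2 + s^2 x - t^2], where
    [r^2], [s^2], [t^2] are the elementary symmetric functions.  Hence
    [a (a^2 + s^2) = (r a)^2 + t^2], so a nonzero [a] is a quotient of two sums
    of two squares.  For the second claim, two squares among [a], [b], [c] force
    the third one to be a square: if the two squares are nonzero, divide [abc] by
    them; if exactly one of them is zero, divide [ab + bc + ca] by the other;
    if both are zero, use [a + b + c]. *)

(** A square root [k] of [n] satisfies [|k| <= k^2 = |n|], so a search through the finitely many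
    naturals up to [|n|] decides the question without excluded middle. *)
Lemma perfect_square_dec (n : int) : perfect_square n \/ ~ perfect_square n.
Proof.
case: (boolP [exists k : 'I_`|n|.+1, n == k%:Z ^+ 2]) => [/existsP[k /eqP nE]|nsq].
  by left; exists k%:Z.
right=> -[k nE]; case/negP: nsq; apply/existsP.
have ltk : (`|k| < `|n|.+1)%N.
  rewrite ltnS nE abszX -mulnn.
  by case: `|k|%N => [|m] //; rewrite leq_pmulr.
by exists (Ordinal ltk); rewrite /= nE abszE Num.Theory.real_normK ?Num.Theory.num_real.
Qed.

(** If [t^2 = m^2 c], then [m^2] divides [t^2], hence [m] divides [t], and the quotient is a root of
    [c]. *)
Lemma perfect_square_divl (m c : int) :
  m != 0 -> perfect_square (m ^+ 2 * c) -> perfect_square c.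
Proof.
move=> m0 [t tE].
have /dvdzP[k kE] : (m %| t)%Z.
  by rewrite -(@dvdz_pexp2r _ _ 2) // -tE dvdz_mulr.
exists k; apply: (mulfI (expf_neq0 2 m0)).
by rewrite tE kE; ring.
Qed.

Lemma perfect_square_third (a b c : int) :
    perfect_square (a + b + c) -> perfect_square (a * b + b * c + c * a) ->
    perfect_square (a * b * c) ->
  perfect_square a -> perfect_square b -> perfect_square c.
Proof.
move=> sum pairs prod [x aE] [y bE]; rewrite {}aE {}bE in sum pairs prod.
have [x0|x0] := eqVneq x 0; have [y0|y0] := eqVneq y 0.
- by move: sum; rewrite x0 y0 expr0n !add0r.
- apply: (perfect_square_divl _ _ y0); move: pairs; rewrite x0.
  by congr perfect_square; ring.
- apply: (perfect_square_divl _ _ x0); move: pairs; rewrite y0.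
  by congr perfect_square; ring.
- apply: (@perfect_square_divl (x * y)); first by rewrite mulf_neq0.
  by move: prod; congr perfect_square; ring.
Qed.

Lemma sum_of_two_rational_squares_first (a b c : int) :
    perfect_square (a + b + c) -> perfect_square (a * b + b * c + c * a) ->
    perfect_square (a * b * c) ->
  sum_of_two_rational_squares a.
Proof.
move=> [r rE] [s sE] [t tE].
(* Split off because the later denominator [a^2 + s^2] may vanish when [a = 0]. *)
have [->|a0] := eqVneq a 0; first by exists 0, 0; rewrite expr0n addr0.
have eqZ : a * (a ^+ 2 + s ^+ 2) = (r * a) ^+ 2 + t ^+ 2.
  by rewrite exprMn -rE -sE -tE; ring.
have eqQ : a%:~R * (a%:~R ^+ 2 + s%:~R ^+ 2)
    = (r%:~R * a%:~R) ^+ 2 + t%:~R ^+ 2 :> rat.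
  move/(congr1 (fun z : int => z%:~R : rat)): eqZ.
  by rewrite !(rmorphD, rmorphM, rmorphXn).
have d0 : a%:~R ^+ 2 + s%:~R ^+ 2 != 0 :> rat.
  rewrite Num.Theory.paddr_eq0 ?Num.Theory.sqr_ge0 //.
  by rewrite !sqrf_eq0 intr_eq0 (negPf a0).
set A : rat := a%:~R in eqQ d0 *; set S : rat := s%:~R in eqQ d0.
set U : rat := r%:~R * A in eqQ; set T : rat := t%:~R in eqQ.
(* Brahmagupta's identity, i.e. the quotient (U + iT) / (A + iS). *)
exists ((U * A + T * S) / (A ^+ 2 + S ^+ 2)), ((T * A - U * S) / (A ^+ 2 + S ^+ 2)).
apply: (mulIf d0); rewrite eqQ; field; exact: d0.
Qed.

(** Cyclic symmetry carries the results for one position over to the other two. *)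
Lemma symmetric_squares_rot (a b c : int) :
    perfect_square (a + b + c) -> perfect_square (a * b + b * c + c * a) ->
    perfect_square (a * b * c) ->
  [/\ perfect_square (b + c + a), perfect_square (b * c + c * a + a * b)
    & perfect_square (b * c * a)].
Proof.
move=> sum pairs prod; split.
- by move: sum; congr perfect_square; ring.
- by move: pairs; congr perfect_square; ring.
- by move: prod; congr perfect_square; ring.
Qed.

Theorem mainTheorem1 (a b c : int)
    (h_sum : perfect_square (a + b + c))
    (h_pairs : perfect_square (a * b + b * c + c * a))
    (h_prod : perfect_square (a * b * c)) :
  [/\ sum_of_two_rational_squares a,
      sum_of_two_rational_squares b
    & sum_of_two_rational_squares c] /\
  [\/ exactly_one (perfect_square a) (perfect_square b) (perfect_square c),
      [/\ perfect_square a, perfect_square b & perfect_square c]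
    | [/\ ~ perfect_square a, ~ perfect_square b & ~ perfect_square c]].
Proof.
have [sum' pairs' prod'] := symmetric_squares_rot _ _ _ h_sum h_pairs h_prod.
have [sum'' pairs'' prod''] := symmetric_squares_rot _ _ _ sum' pairs' prod'.
split.
  split; [exact: sum_of_two_rational_squares_first h_sum h_pairs h_prod
         |exact: sum_of_two_rational_squares_first sum' pairs' prod'
         |exact: sum_of_two_rational_squares_first sum'' pairs'' prod''].
have abc := perfect_square_third _ _ _ h_sum h_pairs h_prod.
have bca := perfect_square_third _ _ _ sum' pairs' prod'.
have cab := perfect_square_third _ _ _ sum'' pairs'' prod''.
rewrite /exactly_one.
(* Of the eight cases, the three with exactly two squares are contradictory by [abc], [bca],
   [cab]. *)
have [sa|na] := perfect_square_dec a; have [sb|nb] := perfect_square_dec b;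
  have [sc|nc] := perfect_square_dec c.
- by constructor 2.
- by case: nc; apply: abc.
- by case: nb; apply: cab.
- by constructor 1; constructor 1.
- by case: na; apply: bca.
- by constructor 1; constructor 2.
- by constructor 1; constructor 3.
- by constructor 3.
Qed.
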